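(* Let $(\mathfrak{L},[\cdot,\cdot],\alpha)$ be a multiplicative Hom-Lie superalgebra and let $r\in\mathfrak{L}^{\otimes2}$ be an even element ($|r|=\bar0$) such that $\alpha^{\otimes2}(r)=r$, $r_{21}=-r$, and $[[r,r]]^\alpha=0$. Then $(\mathfrak{L},[\cdot,\cdot],ad(r),\alpha,r)$ is a multiplicative quasi-triangular Hom-Lie superbialgebra.
   Context: $\mathbb{K}$ is a field of characteristic $0$; superspaces are $\mathbb{Z}_2$-graded; $|x|$ is the parity of a homogeneous $x$. $\tau(x\otimes y)=(-1)^{|x||y|}y\otimes x$, and $\xi(x\otimes y\otimes z)=(-1)^{|x|(|y|+|z|)}y\otimes z\otimes x$. For $r=\sum r_1\otimes r_2$ with homogeneous $r_1,r_2$, $|r|=|r_1|+|r_2|$ and $r_{21}=\tau(r)$. A Hom-Lie superalgebra $(\mathfrak{L},[\cdot,\cdot],\alpha)$ is a superspace with an even bilinear bracket and an even linear map $\alpha$ with $[x,y]=-(-1)^{|x||y|}[y,x]$ and $(-1)^{|x||z|}[\alpha(x),[y,z]]+(-1)^{|z||y|}[\alpha(z),[x,y]]+(-1)^{|y||x|}[\alpha(y),[z,x]]=0$; it is multiplicative if $\alpha([x,y])=[\alpha(x),\alpha(y)]$. A Hom-Lie supercoalgebra $(\mathfrak{L},\Delta,\alpha)$ is a superspace with an even linear map $\alpha$ and an even linear map $\Delta:\mathfrak{L}\to\mathfrak{L}\otimes\mathfrak{L}$ with $\mathrm{Im}\,\Delta\subset\mathrm{Im}(1\otimes1-\tau)$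 and $(1\otimes1\otimes1+\xi+\xi^2)\circ(\alpha\otimes\Delta)\circ\Delta=0$; it is co-multiplicative if $\Delta\circ\alpha=\alpha^{\otimes2}\circ\Delta$. $ad_x(y_1\otimes y_2)=[x,y_1]\otimes\alpha(y_2)+(-1)^{|x||y_1|}\alpha(y_1)\otimes[x,y_2]$, and $ad(r):\mathfrak{L}\to\mathfrak{L}^{\otimes2}$ is $ad(r)(x)=ad_x(r)$. A (multiplicative) Hom-Lie superbialgebra $(\mathfrak{L},[\cdot,\cdot],\Delta,\alpha)$ consists of a (multiplicative) Hom-Lie superalgebra $(\mathfrak{L},[\cdot,\cdot],\alpha)$ and a (co-multiplicative) Hom-Lie supercoalgebra $(\mathfrak{L},\Delta,\alpha)$ with $\Delta([x,y])=ad_{\alpha(x)}(\Delta(y))-(-1)^{|x||y|}ad_{\alpha(y)}(\Delta(x))$. A (multiplicative) coboundary Hom-Lie superbialgebra $(\mathfrak{L},[\cdot,\cdot],\Delta,\alpha,r)$ is a (multiplicative) Hom-Lie superbialgebra with an even element $r\in\mathfrak{L}^{\otimes2}$ such that $\alpha^{\otimes2}(r)=r$ and $\Delta=ad(r)$. It is quasi-triangular if moreover $[[r,r]]^\alpha=0$. With $r'=\sum r_1'\otimes r_2'$ a second copy of $r$, $[[r,r]]^\alpha=[r_{12},r_{13}]+[r_{12},r_{23}]+[r_{13},r_{23}]\in\mathfrak{L}^{\otimes3}$, where $[r_{12},r_{13}]=\sum(-1)^{|r_1'||r_2|}[r_1,r_1']\otimes\alpha(r_2)\otimes\alpha(r_2')$,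 $[r_{12},r_{23}]=\sum\alpha(r_1)\otimes[r_2,r_1']\otimes\alpha(r_2')$, $[r_{13},r_{23}]=\sum(-1)^{|r_1'||r_2|}\alpha(r_1)\otimes\alpha(r_1')\otimes[r_2,r_2']$. *)

(* Defs.v *)
From HB Require Import structures.
From mathcomp Require Import all_boot all_order all_algebra.
From mathcomp Require Import sesquilinear.
From mathcomp Require Import boolp.

Set Implicit Arguments.
Unset Strict Implicit.
Unset Printing Implicit Defensive.

Import GRing.Theory.
Local Open Scope ring_scope.

Notation bilinear_fun f := (bilinear_for *:%R *:%R f).

(* The list [:: (u_1, v_1); ...; (u_n, v_n)] stands for the formal sum
   u_1 (x) v_1 + ... + u_n (x) v_n; the tensor product is the set of formal
   sums modulo the congruence generated by bilinearity. *)
Inductive tensor_rel (K : fieldType) (U V : lmodType K) :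
    seq (U * V) -> seq (U * V) -> Prop :=
| TRefl s : tensor_rel s s
| TSym s t : tensor_rel s t -> tensor_rel t s
| TTrans s t w : tensor_rel s t -> tensor_rel t w -> tensor_rel s w
| TCat s s' t t' :
    tensor_rel s s' -> tensor_rel t t' -> tensor_rel (s ++ t) (s' ++ t')
| TComm s t : tensor_rel (s ++ t) (t ++ s)
| TZero v : tensor_rel [:: (0, v)] [::]
| TAddl u u' v : tensor_rel [:: (u + u', v)] [:: (u, v); (u', v)]
| TAddr u v v' : tensor_rel [:: (u, v + v')] [:: (u, v); (u, v')]
| TScale a u v : tensor_rel [:: (a *: u, v)] [:: (u, a *: v)].

Section TensorQuotient.
Variables (K : fieldType) (U V : lmodType K).
Local Open Scope quotient_scope.

Definition tensor_relb (s t : seq (U * V)) : bool := `[< tensor_rel s t >].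

Lemma tensor_relb_refl : reflexive tensor_relb.
Proof. by move=> s; apply/asboolP; exact: TRefl. Qed.

Lemma tensor_relb_sym : symmetric tensor_relb.
Proof. by move=> s t; apply/asboolP/asboolP; exact: TSym. Qed.

Lemma tensor_relb_trans : transitive tensor_relb.
Proof.
by move=> t s w /asboolP st /asboolP tw; apply/asboolP; exact: TTrans st tw.
Qed.

Canonical tensor_equiv :=
  EquivRel tensor_relb tensor_relb_refl tensor_relb_sym tensor_relb_trans.

Definition tensor : Type := {eq_quot tensor_equiv}.
HB.instance Definition _ := Choice.on tensor.
HB.instance Definition _ := EqQuotient.on tensor.

Lemma tensorP (s t : seq (U * V)) :
  tensor_rel s t <-> \pi_tensor s = \pi_tensor t.
Proof.
split=> [st|/eqmodP/asboolP //].
by apply/eqmodP; apply/asboolP.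
Qed.

Lemma tensorW (P : tensor -> Prop) :
  (forall s, P (\pi_tensor s)) -> forall x, P x.
Proof. by move=> h x; rewrite -[x]reprK; exact: h. Qed.

Lemma tensor_repr_rel (s : seq (U * V)) : tensor_rel (repr (\pi_tensor s)) s.
Proof. by apply/tensorP; rewrite reprK. Qed.

Let tscale (a : K) (s : seq (U * V)) := [seq (a *: p.1, p.2) | p <- s].

Lemma tensor_rel_scale a s t :
  tensor_rel s t -> tensor_rel (tscale a s) (tscale a t).
Proof.
elim=> {s t} /=.
- by move=> s; exact: TRefl.
- by move=> s t _; exact: TSym.
- by move=> s t w _ st _; exact: TTrans.
- by move=> s s' t t' _ ss' _ tt'; rewrite /tscale !map_cat; exact: TCat.
- by move=> s t; rewrite /tscale !map_cat; exact: TComm.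
- by move=> v; rewrite scaler0; exact: TZero.
- by move=> u u' v; rewrite scalerDr; exact: TAddl.
- by move=> u v v'; exact: TAddr.
- by move=> b u v; rewrite scalerA mulrC -scalerA; exact: TScale.
Qed.

Definition tensor_zero : tensor := \pi_tensor [::].
Definition tensor_add (x y : tensor) : tensor := \pi_tensor (repr x ++ repr y).
Definition tensor_scale (a : K) (x : tensor) : tensor :=
  \pi_tensor (tscale a (repr x)).
Definition tensor_opp (x : tensor) : tensor := tensor_scale (-1) x.

Lemma tensor_addE s t :
  tensor_add (\pi_tensor s) (\pi_tensor t) = \pi_tensor (s ++ t).
Proof. by apply/tensorP; apply: TCat; exact: tensor_repr_rel. Qed.

Lemma tensor_scaleE a s :
  tensor_scale a (\pi_tensor s) = \pi_tensor (tscale a s).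
Proof. by apply/tensorP/tensor_rel_scale; exact: tensor_repr_rel. Qed.

Lemma tensor_addA : associative tensor_add.
Proof.
move=> x y z; elim/tensorW: x => s; elim/tensorW: y => t; elim/tensorW: z => w.
by rewrite !tensor_addE catA.
Qed.

Lemma tensor_addC : commutative tensor_add.
Proof.
move=> x y; elim/tensorW: x => s; elim/tensorW: y => t; rewrite !tensor_addE.
by apply/tensorP; exact: TComm.
Qed.

Lemma tensor_add0 : left_id tensor_zero tensor_add.
Proof. by move=> x; elim/tensorW: x => s; rewrite tensor_addE. Qed.

Lemma tensor_rel_scaleDl s a b :
  tensor_rel (tscale (a + b) s) (tscale a s ++ tscale b s).
Proof.
elim: s => [|[u v] s ih]; first exact: TRefl.
rewrite /tscale /= -/(tscale _ _) -/(tscale _ _).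
apply: TTrans (_ : tensor_rel _
  ([:: (a *: u, v); (b *: u, v)] ++ (tscale a s ++ tscale b s))) _.
  rewrite -cat1s; apply: TCat => //; rewrite scalerDl; exact: TAddl.
set p := (a *: u, v); set q := (b *: u, v); set A := tscale a s; set B := tscale b s.
apply: (@TCat _ _ _ [:: p] [:: p] (q :: A ++ B) (A ++ q :: B)); first exact: TRefl.
rewrite -[q :: B]cat1s catA -cat_cons -cat1s.
by apply: TCat; [exact: TComm|exact: TRefl].
Qed.

Lemma tensor_rel_scale0 s : tensor_rel (tscale 0 s) [::].
Proof.
elim: s => [|[u v] s ih]; first exact: TRefl.
rewrite /tscale /= -/(tscale _ _) -cat1s -[X in tensor_rel _ X]cats0.
by apply: TCat => //; rewrite scale0r; exact: TZero.
Qed.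

Lemma tscale1 s : tscale 1 s = s.
Proof. by elim: s => //= -[u v] s ->; rewrite scale1r. Qed.

Lemma tensor_addN : left_inverse tensor_zero tensor_opp tensor_add.
Proof.
move=> x; elim/tensorW: x => s; rewrite /tensor_opp tensor_scaleE tensor_addE.
apply/tensorP; rewrite -{2}[s]tscale1.
apply: TTrans (TSym (tensor_rel_scaleDl _ _ _)) _.
by rewrite addNr; exact: tensor_rel_scale0.
Qed.

HB.instance Definition _ :=
  GRing.isZmodule.Build tensor tensor_addA tensor_addC tensor_add0 tensor_addN.

Lemma tensor_scaleA a b x :
  tensor_scale a (tensor_scale b x) = tensor_scale (a * b) x.
Proof.
elim/tensorW: x => s; rewrite !tensor_scaleE /tscale -map_comp.
by congr (\pi_tensor _); apply: eq_map => p /=; rewrite scalerA.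
Qed.

Lemma tensor_scale1 : left_id 1 tensor_scale.
Proof. by move=> x; elim/tensorW: x => s; rewrite tensor_scaleE tscale1. Qed.

Lemma tensor_scaleDr : right_distributive tensor_scale +%R.
Proof.
move=> a x y; elim/tensorW: x => s; elim/tensorW: y => t.
rewrite {1}/GRing.add /= tensor_addE !tensor_scaleE /tscale map_cat.
by rewrite [RHS]tensor_addE.
Qed.

Lemma tensor_scaleDl x : {morph tensor_scale^~ x : a b / a + b}.
Proof.
move=> a b; elim/tensorW: x => s; rewrite !tensor_scaleE [RHS]tensor_addE.
by apply/tensorP; exact: tensor_rel_scaleDl.
Qed.

HB.instance Definition _ := GRing.Zmodule_isLmodule.Build K tensor
  tensor_scaleA tensor_scale1 tensor_scaleDr tensor_scaleDl.

Definition tens (u : U) (v : V) : tensor := \pi_tensor [:: (u, v)].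

End TensorQuotient.

Infix "\ot" := tens (at level 38, left associativity) : ring_scope.

Section TensorLift.
Variables (K : fieldType) (U V : lmodType K).

Lemma tens_bilinear : bilinear_fun (@tens K U V).
Proof.
split=> [v a x y|u a x y] /=.
  rewrite [LHS](_ : _ = tens (a *: x) v + tens y v).
    by rewrite [_ *: tens x v]tensor_scaleE.
  by rewrite [RHS]tensor_addE; apply/tensorP; exact: TAddl.
rewrite [LHS](_ : _ = tens u (a *: x) + tens u y).
  congr (_ + _); rewrite [RHS]tensor_scaleE.
  by apply/tensorP/TSym; exact: TScale.
by rewrite [RHS]tensor_addE; apply/tensorP; exact: TAddr.
Qed.

HB.instance Definition _ := bilinear_isBilinear.Build K U V (tensor U V)
  *:%R *:%R (@tens K U V) tens_bilinear.

Lemma tensor_repr (t : tensor U V) : t = \sum_(p <- repr t) p.1 \ot p.2.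
Proof.
rewrite -[LHS]reprK; elim: (repr t) => [|[u v] s ih]; first by rewrite big_nil.
by rewrite big_cons -ih [RHS]tensor_addE.
Qed.

Lemma tensor_ind (P : tensor U V -> Prop) :
  P 0 -> (forall u v t, P t -> P (u \ot v + t)) -> forall t, P t.
Proof.
move=> P0 PD t; rewrite [t]tensor_repr; elim: (repr t) => [|p s ih].
  by rewrite big_nil.
by rewrite big_cons; exact: PD.
Qed.

Variable W : lmodType K.

(* The linear map t = sum u (x) v |-> sum f u v induced by f : U -> V -> W.
   It is well defined, and linear, as soon as f is bilinear: see tliftE,
   tlift_linear and tlift_unique. *)
Definition tlift (f : U -> V -> W) (t : tensor U V) : W :=
  \sum_(p <- repr t) f p.1 p.2.

Section Bilinear.
Variables (f : U -> V -> W) (fbil : bilinear_fun f).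

Let fDl u u' v : f (u + u') v = f u v + f u' v.
Proof. by have := fbil.1 v 1 u u'; rewrite /= !scale1r. Qed.
Let fDr u v v' : f u (v + v') = f u v + f u v'.
Proof. by have := fbil.2 u 1 v v'; rewrite /= !scale1r. Qed.
Let f0l v : f 0 v = 0.
Proof. by apply: (addrI (f 0 v)); rewrite -fDl !addr0. Qed.
Let f0r u : f u 0 = 0.
Proof. by apply: (addrI (f u 0)); rewrite -fDr !addr0. Qed.
Let fZl a u v : f (a *: u) v = a *: f u v.
Proof. by have := fbil.1 v a u 0; rewrite /= f0l !addr0. Qed.
Let fZr a u v : f u (a *: v) = a *: f u v.
Proof. by have := fbil.2 u a v 0; rewrite /= f0r !addr0. Qed.

Lemma tensor_rel_lift s t : tensor_rel s t ->
  \sum_(p <- s) f p.1 p.2 = \sum_(p <- t) f p.1 p.2.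
Proof.
elim=> {s t} //.
- by move=> s t w _ -> _ ->.
- by move=> s s' t t' _ ih1 _ ih2; rewrite !big_cat /= ih1 ih2.
- by move=> s t; rewrite !big_cat /= addrC.
- by move=> v; rewrite big_seq1 big_nil f0l.
- by move=> u u' v; rewrite !big_cons !big_nil !addr0 fDl.
- by move=> u v v'; rewrite !big_cons !big_nil !addr0 fDr.
- by move=> a u v; rewrite !big_seq1 fZl fZr.
Qed.

Lemma tliftE u v : tlift f (u \ot v) = f u v.
Proof. by rewrite /tlift (tensor_rel_lift (tensor_repr_rel _)) big_seq1. Qed.

Lemma tlift_linear : linear (tlift f).
Proof.
move=> a x y; elim/tensorW: x => s; elim/tensorW: y => t.
rewrite [a *: _]tensor_scaleE [X in tlift f X]tensor_addE /tlift.
rewrite !(tensor_rel_lift (tensor_repr_rel _)) big_cat big_map scaler_sumr.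
by congr (_ + _); apply: eq_bigr => p _; rewrite fZl.
Qed.

Lemma tlift_unique (g : {linear tensor U V -> W}) :
  (forall u v, g (u \ot v) = f u v) -> forall t, g t = tlift f t.
Proof.
move=> gE t; rewrite {1}[t]tensor_repr linear_sum.
by apply: eq_bigr => p _; exact: gE.
Qed.

End Bilinear.

Lemma tlift_ext (f g : U -> V -> W) t : f =2 g -> tlift f t = tlift g t.
Proof. by move=> fg; apply: eq_bigr => p _; exact: fg. Qed.

Lemma tlift_lin (a : K) (f g : U -> V -> W) t :
  tlift (fun u v => a *: f u v + g u v) t = a *: tlift f t + tlift g t.
Proof. by rewrite /tlift big_split /= scaler_sumr. Qed.

End TensorLift.

(* [homog i] is the homogeneous component of parity i (false = even,
   true = odd); the space is the direct sum of its two components. *)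
HB.mixin Record isSuperspace (K : fieldType) V of GRing.Lmodule K V := {
  homog : bool -> V -> Prop;
  homog0 : forall i, homog i 0;
  homogP : forall i a x y, homog i x -> homog i y -> homog i (a *: x + y);
  homog_sum : forall x, exists x0 x1,
    [/\ homog false x0, homog true x1 & x = x0 + x1];
  homog_cap : forall x, homog false x -> homog true x -> x = 0
}.

#[short(type="superspaceType")]
HB.structure Definition Superspace (K : fieldType) :=
  {V of GRing.Lmodule K V & isSuperspace K V}.

Section Components.
Variables (K : fieldType) (V : superspaceType K).
Implicit Types (x y : V) (i j : bool).

Lemma hpart_ex x : exists p : V * V,
  [/\ homog false p.1, homog true p.2 & x = p.1 + p.2].
Proof. by have [x0 [x1 h]] := homog_sum x; exists (x0, x1). Qed.

Definition hpart i x : V :=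
  let p := projT1 (cid (hpart_ex x)) in if i then p.2 else p.1.

Lemma hpart_homog i x : homog i (hpart i x).
Proof. rewrite /hpart; by case: (cid _) => p [h0 h1 e]; case: i. Qed.

Lemma hpart_sum x : x = hpart false x + hpart true x.
Proof. by rewrite /hpart; case: (cid _) => p [h0 h1 e]. Qed.

Lemma homogD i x y : homog i x -> homog i y -> homog i (x + y).
Proof. by move=> hx hy; rewrite -[x]scale1r; exact: homogP. Qed.

Lemma homogZ i a x : homog i x -> homog i (a *: x).
Proof. by move=> hx; rewrite -[_ *: _]addr0; apply: homogP => //; exact: homog0. Qed.

Lemma homogN i x : homog i x -> homog i (- x).
Proof. by rewrite -scaleN1r; exact: homogZ. Qed.

Lemma hpart_unique x x0 x1 : homog false x0 -> homog true x1 ->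
  x = x0 + x1 -> hpart false x = x0 /\ hpart true x = x1.
Proof.
move=> h0 h1 e; have e0 := hpart_sum x.
have d : hpart false x - x0 = x1 - hpart true x.
  by apply/eqP; rewrite subr_eq addrAC -subr_eq opprK -e0 addrC -e.
have z : hpart false x - x0 = 0.
  apply: homog_cap; first by apply: homogD (hpart_homog _ _) (homogN h0).
  by rewrite d; apply: homogD h1 (homogN (hpart_homog true x)).
by split; apply/eqP; [rewrite -subr_eq0 z|rewrite eq_sym -subr_eq0 -d z].
Qed.

Lemma hpart_linear i : linear (hpart i).
Proof.
move=> a x y.
have [e0 e1] : hpart false (a *: x + y) = a *: hpart false x + hpart false y /\
               hpart true (a *: x + y) = a *: hpart true x + hpart true y.
  apply: hpart_unique.
  - by apply: homogP; exact: hpart_homog.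
  - by apply: homogP; exact: hpart_homog.
  by rewrite {1}[x]hpart_sum {1}[y]hpart_sum scalerDr addrACA.
by case: i.
Qed.

HB.instance Definition _ i :=
  GRing.isLinear.Build K V V *:%R (hpart i) (hpart_linear i).

Lemma hpart_id i j x : homog i x -> hpart j x = if j == i then x else 0.
Proof.
move=> hx; case: i hx => hx.
  have [|e0 e1] := @hpart_unique x 0 x (homog0 _) hx; first by rewrite add0r.
  by case: j.
have [|e0 e1] := @hpart_unique x x 0 hx (homog0 _); first by rewrite addr0.
by case: j.
Qed.

End Components.

Arguments hpart {K V} i x : simpl never.

Definition even_map (K : fieldType) (U V : superspaceType K) (f : U -> V) : Prop :=
  forall i x, homog i x -> homog i (f x).

(* Bilinear extension of (x, y) |-> (-1)^(|x||y|) f x y from homogeneous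
   elements to all elements: see koszulE. *)
Definition koszul (K : fieldType) (U V : superspaceType K) (W : lmodType K)
    (f : U -> V -> W) (x : U) (y : V) : W :=
  \sum_(i : bool) \sum_(j : bool) (-1) ^+ (i && j) *: f (hpart i x) (hpart j y).

Section Koszul.
Variables (K : fieldType) (U V : superspaceType K) (W : lmodType K).

Lemma koszul_bilinear (f : U -> V -> W) :
  bilinear_fun f -> bilinear_fun (koszul f).
Proof.
move=> fbil; split=> [y a x x'|x a y y'] /=; rewrite /koszul.
  rewrite scaler_sumr -big_split /=; apply: eq_bigr => i _.
  rewrite scaler_sumr -big_split /=; apply: eq_bigr => j _.
  by rewrite linearP (fbil.1 _ _ _ _) scalerDr !scalerA mulrC.
rewrite scaler_sumr -big_split /=; apply: eq_bigr => i _.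
rewrite scaler_sumr -big_split /=; apply: eq_bigr => j _.
by rewrite linearP (fbil.2 _ _ _ _) scalerDr !scalerA mulrC.
Qed.

Lemma koszulE (f : U -> V -> W) i j x y : bilinear_fun f ->
  homog i x -> homog j y -> koszul f x y = (-1) ^+ (i && j) *: f x y.
Proof.
move=> fbil hx hy.
have f0l v : f 0 v = 0.
  by have := fbil.1 v (-1) 0 0; rewrite /= scaler0 addr0 scaleN1r addNr.
have f0r u : f u 0 = 0.
  by have := fbil.2 u (-1) 0 0; rewrite /= scaler0 addr0 scaleN1r addNr.
rewrite /koszul !big_bool /= !(hpart_id _ hx) !(hpart_id _ hy).
by case: i {hx}; case: j {hy}; rewrite /= ?f0l ?f0r ?scaler0 ?addr0 ?add0r.
Qed.

End Koszul.

Section TensorSuperspace.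
Variables (K : fieldType) (U V : superspaceType K).
Implicit Types (s t : tensor U V) (k : bool).

Definition tensor_homog k t : Prop := exists s : seq (U * V),
  t = \sum_(p <- s) p.1 \ot p.2 /\
  (forall p, p \in s ->
     exists i j, [/\ homog i p.1, homog j p.2 & i (+) j = k]).

Lemma tensor_homog_tens i j (u : U) (v : V) :
  homog i u -> homog j v -> tensor_homog (i (+) j) (u \ot v).
Proof.
move=> hu hv; exists [:: (u, v)]; rewrite big_seq1; split=> // p.
by rewrite inE => /eqP ->; exists i, j.
Qed.

Lemma tensor_homog0 k : tensor_homog k 0.
Proof. by exists [::]; rewrite big_nil. Qed.

Lemma tensor_homogP k a s t :
  tensor_homog k s -> tensor_homog k t -> tensor_homog k (a *: s + t).
Proof.
move=> [l [-> hl]] [m [-> hm]].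
exists ([seq (a *: p.1, p.2) | p <- l] ++ m); split.
  rewrite big_cat big_map scaler_sumr /=; congr (_ + _).
  by apply: eq_bigr => p _; rewrite linearZl_LR.
move=> p; rewrite mem_cat => /orP[/mapP[q /hl[i [j [h1 h2 h3]]] ->]|/hm //].
by exists i, j; split=> //; exact: homogZ.
Qed.

Lemma tensor_homog_sum t : exists t0 t1,
  [/\ tensor_homog false t0, tensor_homog true t1 & t = t0 + t1].
Proof.
have hD k x y : tensor_homog k x -> tensor_homog k y -> tensor_homog k (x + y).
  by move=> hx; rewrite -[x]scale1r; exact: tensor_homogP.
elim/tensor_ind: t => [|u v t [t0 [t1 [h0 h1 ->]]]].
  by exists 0, 0; rewrite addr0; split=> //; exact: tensor_homog0.
have hp i j : tensor_homog (i (+) j) (hpart i u \ot hpart j v).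
  by apply: tensor_homog_tens; exact: hpart_homog.
exists (hpart false u \ot hpart false v + hpart true u \ot hpart true v + t0).
exists (hpart false u \ot hpart true v + hpart true u \ot hpart false v + t1).
split.
- by apply: (hD) h0; apply: (hD); [exact: (hp false false)|exact: (hp true true)].
- by apply: (hD) h1; apply: (hD); [exact: (hp false true)|exact: (hp true false)].
rewrite {1}[u]hpart_sum {1}[v]hpart_sum linearDl !linearDr [RHS]addrACA.
by congr (_ + _); rewrite [X in _ + X = _]addrC addrACA.
Qed.

Lemma tensor_homog_cap t : tensor_homog false t -> tensor_homog true t -> t = 0.
Proof.
pose f k (u : U) (v : V) : tensor U V := \sum_(i : bool) hpart i u \ot hpart (i (+) k) v.
have fbil k : bilinear_fun (f k).
  split=> [v a x y|u a x y] /=; rewrite /f scaler_sumr -big_split /=;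
    apply: eq_bigr => i _; rewrite linearP.
    by rewrite linearPl.
  by rewrite linearPr.
have fE k l : tensor_homog l t -> tlift (f k) t = if k == l then t else 0.
  move=> [s [-> hs]].
  rewrite -[LHS]/((HB.pack (tlift (f k)) (GRing.isLinear.Build _ _ _ _ _ (tlift_linear (fbil k))) : {linear tensor U V -> tensor U V}) _).
  rewrite linear_sum /=.
  have -> (x : tensor U V) : (if k == l then x else 0) = (k == l)%:R *: x.
    by case: eqP => _; rewrite ?scale1r ?scale0r.
  rewrite scaler_sumr big_seq [RHS]big_seq; apply: eq_bigr => p /hs[i [j [hi hj ijl]]].
  rewrite (tliftE (fbil k)) /f big_bool !(hpart_id _ hi) !(hpart_id _ hj) -ijl.
  by case: k {fbil}; case: i {hi ijl}; case: j {hj};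
     rewrite /= ?linear0l ?linear0r ?addr0 ?add0r ?scale1r ?scale0r.
by move=> h0 h1; rewrite -[LHS](fE false false h0) (fE false true h1).
Qed.

HB.instance Definition _ := isSuperspace.Build K (tensor U V)
  tensor_homog0 tensor_homogP tensor_homog_sum tensor_homog_cap.

End TensorSuperspace.

Lemma bilinear_funP (K : fieldType) (U V W : lmodType K)
  (f : {bilinear U -> V -> W}) : bilinear_fun f.
Proof. by split=> [v a x y|u a x y] /=; rewrite (linearPl, linearPr). Qed.

Section TensorMap.
Variables (K : fieldType) (U V U' V' : lmodType K).
Variables (f : {linear U -> U'}) (g : {linear V -> V'}).

Definition tmap : tensor U V -> tensor U' V' := tlift (fun u v => f u \ot g v).

Lemma tmap_bilinear : bilinear_fun (fun u v => f u \ot g v).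
Proof. by split=> [v a x y|u a x y] /=; rewrite linearP (linearPl, linearPr). Qed.

HB.instance Definition _ := GRing.isLinear.Build K (tensor U V) (tensor U' V')
  *:%R tmap (tlift_linear tmap_bilinear).

Lemma tmapE u v : tmap (u \ot v) = f u \ot g v.
Proof. exact: tliftE tmap_bilinear u v. Qed.

End TensorMap.

Section Permutations.
Variables (K : fieldType) (L : superspaceType K).

Definition tau : tensor L L -> tensor L L :=
  tlift (koszul (fun x y => y \ot x)).

Lemma tau_bilinear : bilinear_fun (fun x y : L => y \ot x).
Proof. by split=> [v a x y|u a x y] /=; rewrite (linearPl, linearPr). Qed.

HB.instance Definition _ := GRing.isLinear.Build K (tensor L L) (tensor L L)
  *:%R tau (tlift_linear (koszul_bilinear tau_bilinear)).

Lemma tauE i j (x y : L) : homog i x -> homog j y ->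
  tau (x \ot y) = (-1) ^+ (i && j) *: (y \ot x).
Proof.
move=> hx hy; rewrite /tau (tliftE (koszul_bilinear tau_bilinear)).
exact: (koszulE tau_bilinear hx hy).
Qed.

(* The triple tensor power of L is L (x) (L (x) L). *)
Definition rot3 (x : L) : tensor L L -> tensor L (tensor L L) :=
  tlift (fun y z => y \ot (z \ot x)).

Lemma rot3_bilinear : bilinear_fun rot3.
Proof.
have h (x : L) : bilinear_fun (fun y z : L => y \ot (z \ot x)).
  split=> [v a y z|u a y z] /=; first by rewrite linearPl.
  by rewrite linearPl linearPr.
split=> [t a x y|x] /=; last exact: (tlift_linear (h x)).
by rewrite /rot3 -tlift_lin; apply: tlift_ext => u v; rewrite !linearPr.
Qed.

Definition xi : tensor L (tensor L L) -> tensor L (tensor L L) :=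
  tlift (koszul rot3).

HB.instance Definition _ := GRing.isLinear.Build K
  (tensor L (tensor L L)) (tensor L (tensor L L))
  *:%R xi (tlift_linear (koszul_bilinear rot3_bilinear)).

Lemma xiE i j k (x y z : L) : homog i x -> homog j y -> homog k z ->
  xi (x \ot (y \ot z)) = (-1) ^+ (i && (j (+) k)) *: (y \ot (z \ot x)).
Proof.
move=> hx hy hz; rewrite /xi (tliftE (koszul_bilinear rot3_bilinear)).
rewrite (koszulE rot3_bilinear hx (tensor_homog_tens hy hz)); congr (_ *: _).
rewrite /rot3 tliftE //; split=> [v a u w|u a v w] /=; first by rewrite linearPl.
by rewrite linearPl linearPr.
Qed.

End Permutations.

Section Adjoint.
Variables (K : fieldType) (L : superspaceType K).
Variables (br : {bilinear L -> L -> L}) (alpha : {linear L -> L}).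

Definition ad_fun (x y1 y2 : L) : tensor L L :=
  br x y1 \ot alpha y2 + koszul (fun x y1 => alpha y1 \ot br x y2) x y1.

Definition ad_ (x : L) : tensor L L -> tensor L L := tlift (ad_fun x).

Definition ad (r : tensor L L) (x : L) : tensor L L := ad_ x r.

Lemma ad_fun_bil y2 : bilinear_fun (fun x y1 : L => alpha y1 \ot br x y2).
Proof.
split=> [v a x y|u a x y] /=; first by rewrite linearPl linearPr.
by rewrite linearP linearPl.
Qed.

Lemma ad_fun_linear_x a x x' y1 y2 :
  ad_fun (a *: x + x') y1 y2 = a *: ad_fun x y1 y2 + ad_fun x' y1 y2.
Proof.
rewrite /ad_fun linearPl linearPl /=.
rewrite ((koszul_bilinear (ad_fun_bil y2)).1 y1 a x x') /=.
by rewrite scalerDr addrACA.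
Qed.

Lemma ad_fun_bilinear x : bilinear_fun (ad_fun x).
Proof.
split=> [y2 a y z|y1 a y z] /=; rewrite /ad_fun.
  rewrite linearPr linearPl ((koszul_bilinear (ad_fun_bil y2)).2 x a y z) /=.
  by rewrite scalerDr addrACA.
rewrite linearP linearPr scalerDr addrACA; congr (_ + _).
rewrite /koszul scaler_sumr -big_split /=; apply: eq_bigr => i _.
rewrite scaler_sumr -big_split /=; apply: eq_bigr => j _.
by rewrite !linearPr scalerDr !scalerA mulrC.
Qed.

Lemma ad_linear r : linear (ad r).
Proof.
move=> a x y; rewrite /ad /ad_ -tlift_lin.
by apply: tlift_ext => y1 y2; exact: ad_fun_linear_x.
Qed.

HB.instance Definition _ r :=
  GRing.isLinear.Build K L (tensor L L) *:%R (ad r) (ad_linear r).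

Lemma ad_E i j (x y1 y2 : L) : homog i x -> homog j y1 ->
  ad_ x (y1 \ot y2) =
    br x y1 \ot alpha y2 + (-1) ^+ (i && j) *: (alpha y1 \ot br x y2).
Proof.
move=> hx hy; rewrite /ad_ (tliftE (ad_fun_bilinear x)) /ad_fun; congr (_ + _).
exact: (koszulE (ad_fun_bil y2) hx hy).
Qed.

(* For r = sum r1 (x) r2 and r' = sum s1 (x) s2, the three terms
   [r_12, r'_13], [r_12, r'_23] and [r_13, r'_23]. Their sum at r' = r is
   [[r, r]]^alpha (the left-hand side of the classical Hom-Yang-Baxter
   equation). *)
Definition br12_13 (r r' : tensor L L) : tensor L (tensor L L) :=
  tlift (fun r1 r2 => tlift (fun s1 s2 =>
    koszul (fun r2 s1 => br r1 s1 \ot (alpha r2 \ot alpha s2)) r2 s1) r') r.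

Definition br12_23 (r r' : tensor L L) : tensor L (tensor L L) :=
  tlift (fun r1 r2 => tlift (fun s1 s2 =>
    alpha r1 \ot (br r2 s1 \ot alpha s2)) r') r.

Definition br13_23 (r r' : tensor L L) : tensor L (tensor L L) :=
  tlift (fun r1 r2 => tlift (fun s1 s2 =>
    koszul (fun r2 s1 => alpha r1 \ot (alpha s1 \ot br r2 s2)) r2 s1) r') r.

Definition cybe (r : tensor L L) : tensor L (tensor L L) :=
  br12_13 r r + br12_23 r r + br13_23 r r.

Lemma tlift2E (W : lmodType K) (f : L -> L -> L -> L -> W) (x y x' y' : L) :
  (forall u v, bilinear_fun (f u v)) ->
  (forall u' v', bilinear_fun (fun u v => f u v u' v')) ->
  tlift (fun u v => tlift (f u v) (x' \ot y')) (x \ot y) = f x y x' y'.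
Proof.
move=> h1 h2; rewrite tliftE; first by rewrite tliftE.
split=> [v a u u'|u a v v'] /=; rewrite -tlift_lin; apply: tlift_ext => s t.
  exact: ((h2 s t).1 v a u u').
exact: ((h2 s t).2 u a v v').
Qed.

Lemma koszul_lin (W : lmodType K) a (f g h : L -> L -> W) x y :
  (forall u v, f u v = a *: g u v + h u v) ->
  koszul f x y = a *: koszul g x y + koszul h x y.
Proof.
move=> E; rewrite /koszul scaler_sumr -big_split /=; apply: eq_bigr => i _.
rewrite scaler_sumr -big_split /=; apply: eq_bigr => j _.
by rewrite E scalerDr !scalerA mulrC.
Qed.

Let lin := (linearP, linearPl, linearPr).

Lemma br12_13E i j (r1 r2 s1 s2 : L) : homog i s1 -> homog j r2 ->
  br12_13 (r1 \ot r2) (s1 \ot s2) =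
    (-1) ^+ (i && j) *: (br r1 s1 \ot (alpha r2 \ot alpha s2)).
Proof.
move=> h1 h2; have k u v : bilinear_fun (fun r2 s1 : L =>
    br u s1 \ot (alpha r2 \ot alpha v)).
  by split=> [y a x x'|y a x x'] /=; rewrite !linearP ?linearPl ?linearPr ?linearPl.
rewrite /br12_13 tlift2E; first by rewrite (koszulE (k r1 s2) h2 h1) andbC.
- move=> u v; split=> [t a x y|t a x y] /=.
    exact: ((koszul_bilinear (k u t)).2 v a x y).
  by apply: koszul_lin => p q; rewrite linearP !linearPr.
- move=> u v; split=> [t a x y|t a x y] /=.
    by apply: koszul_lin => p q; rewrite !linearPl.
  exact: ((koszul_bilinear (k t v)).1 u a x y).
Qed.

Lemma br12_23E (r1 r2 s1 s2 : L) :
  br12_23 (r1 \ot r2) (s1 \ot s2) = alpha r1 \ot (br r2 s1 \ot alpha s2).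
Proof.
rewrite /br12_23 tlift2E // => u v; split=> [t a x y|t a x y] /=.
- by rewrite linearPr linearPl linearPr.
- by rewrite linearP !linearPr.
- by rewrite linearP linearPl.
- by rewrite !linearPl linearPr.
Qed.

Lemma br13_23E i j (r1 r2 s1 s2 : L) : homog i s1 -> homog j r2 ->
  br13_23 (r1 \ot r2) (s1 \ot s2) =
    (-1) ^+ (i && j) *: (alpha r1 \ot (alpha s1 \ot br r2 s2)).
Proof.
move=> h1 h2; have k u v : bilinear_fun (fun r2 s1 : L =>
    alpha u \ot (alpha s1 \ot br r2 v)).
  split=> [y a x x'|y a x x'] /=; first by rewrite linearPl !linearPr.
  by rewrite linearP linearPl linearPr.
rewrite /br13_23 tlift2E; first by rewrite (koszulE (k r1 s2) h2 h1) andbC.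
- move=> u v; split=> [t a x y|t a x y] /=.
    exact: ((koszul_bilinear (k u t)).2 v a x y).
  by apply: koszul_lin => p q; rewrite !linearPr.
- move=> u v; split=> [t a x y|t a x y] /=.
    by apply: koszul_lin => p q; rewrite linearP linearPl.
  exact: ((koszul_bilinear (k t v)).1 u a x y).
Qed.

End Adjoint.

Section HomLie.
Variables (K : fieldType) (L : superspaceType K).
Variables (br : {bilinear L -> L -> L}) (Delta : {linear L -> tensor L L}).
Variable alpha : {linear L -> L}.

Record hom_lie_superalgebra : Prop := {
  hls_br_even : forall i j (x y : L),
    homog i x -> homog j y -> homog (i (+) j) (br x y);
  hls_alpha_even : even_map alpha;
  hls_skew : forall i j (x y : L), homog i x -> homog j y ->
    br x y = - ((-1) ^+ (i && j) *: br y x);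
  hls_jacobi : forall i j k (x y z : L), homog i x -> homog j y -> homog k z ->
    (-1) ^+ (i && k) *: br (alpha x) (br y z)
    + (-1) ^+ (k && j) *: br (alpha z) (br x y)
    + (-1) ^+ (j && i) *: br (alpha y) (br z x) = 0
}.

Record multiplicative_hom_lie_superalgebra : Prop := {
  mhls_hom_lie :> hom_lie_superalgebra;
  mhls_mult : forall x y, alpha (br x y) = br (alpha x) (alpha y)
}.

Record hom_lie_supercoalgebra : Prop := {
  hlsc_alpha_even : even_map alpha;
  hlsc_Delta_even : even_map Delta;
  hlsc_skew : forall x, exists t, Delta x = t - tau t;
  hlsc_cojacobi : forall x, let w := tmap alpha Delta (Delta x) in
    w + xi w + xi (xi w) = 0
}.

Record comultiplicative_hom_lie_supercoalgebra : Prop := {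
  chlsc_hom_lie :> hom_lie_supercoalgebra;
  chlsc_comult : forall x, Delta (alpha x) = tmap alpha alpha (Delta x)
}.

Record multiplicative_hom_lie_superbialgebra : Prop := {
  mhlsb_alg : multiplicative_hom_lie_superalgebra;
  mhlsb_coalg : comultiplicative_hom_lie_supercoalgebra;
  mhlsb_compat : forall i j (x y : L), homog i x -> homog j y ->
    Delta (br x y) =
      ad_ br alpha (alpha x) (Delta y)
      - (-1) ^+ (i && j) *: ad_ br alpha (alpha y) (Delta x)
}.

Record multiplicative_coboundary (r : tensor L L) : Prop := {
  mcb_bialg :> multiplicative_hom_lie_superbialgebra;
  mcb_even : homog false r;
  mcb_inv : tmap alpha alpha r = r;
  mcb_ad : forall x, Delta x = ad br alpha r x
}.

Record multiplicative_quasitriangular (r : tensor L L) : Prop := {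
  mqt_coboundary :> multiplicative_coboundary r;
  mqt_cybe : cybe br alpha r = 0
}.

End HomLie.

(* Main.v *)
(** Write r as a sum of a_i (x) b_i with a_i and b_i homogeneous of the same
    parity p_i, so that r_21 = -r lets one exchange a_i and b_i at the cost of
    the sign -(-1)^(p_i). Since alpha^(x)2 fixes r, compatibility of ad(r) with
    the bracket and with alpha only needs the Hom-Jacobi identity and
    multiplicativity. Since K has characteristic 0, tau o ad(r) = - ad(r) puts
    the image of ad(r) inside that of 1 - tau. For the co-Jacobi identity, let
    A1 = [alpha x, -] (x) alpha (x) alpha. Then
      (alpha (x) ad(r)) (ad(r) x) = A1 ([r12, r23] + [r13, r23]) + A + B
    with A and B the two contributions of ad_[x, b_i], and skew-symmetry of r
    together with the Hom-Jacobi identity gives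
      A1 [r12, r13] = xi A + xi^2 B.
    As xi^3 = 1, the cyclic sum of the left-hand side is the cyclic sum of
    A1 [[r, r]]^alpha = 0. *)

Require Import Defs.
From mathcomp Require Import all_boot all_order all_algebra.
From mathcomp Require Import sesquilinear.
From mathcomp Require Import boolp.
From HB Require Import structures.

Import GRing.Theory.
Local Open Scope ring_scope.

Set Implicit Arguments.
Unset Strict Implicit.

(* Otherwise simplification unfolds these maps to sums over [repr] whenever they
   occur under their canonical linear structures. *)
Arguments tau : simpl never.
Arguments xi : simpl never.
Arguments tmap : simpl never.
Arguments ad_ : simpl never.
Arguments ad : simpl never.
Arguments tlift : simpl never.

(** Serves [ad_br]: E and F are mixed terms common to two iterated actions, so they cancel in the
    difference. *)
Lemma subrDD_cross (V : zmodType) (A B C D E F : V) :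
  A - B + (C - D) = A + E + (F + C) - (B + F + (E + D)).
Proof.
rewrite [F + C]addrC [E + D]addrC [A + E + _]addrACA [B + F + _]addrACA.
by rewrite [F + E]addrC [B + D + _]addrC addrKA opprD addrACA.
Qed.

(** * Homogeneous decompositions, skew-symmetric tensors and the cyclic permutation *)

Section Tensors.
Variable K : fieldType.

(** Splitting both factors into even and odd parts leaves homogeneous pure tensors, on which the
    Koszul signs are explicit. *)
Lemma tensor_linear_ext (U V : superspaceType K) (W : lmodType K)
    (f g : {linear tensor U V -> W}) :
  (forall i j u v, homog i u -> homog j v -> f (u \ot v) = g (u \ot v)) ->
  f =1 g.
Proof.
move=> fg; elim/tensor_ind=> [|u v t ih]; first by rewrite !linear0.
rewrite !linearD ih; congr (_ + _).
rewrite [u]hpart_sum [v]hpart_sum linearDl !linearDr !linearD /=.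
by rewrite !(fg _ _ _ _ (hpart_homog _ _) (hpart_homog _ _)).
Qed.

HB.instance Definition _ (U V : lmodType K) (u : U) :=
  GRing.isLinear.Build K V (tensor U V) *:%R (@tens K U V u)
    ((tens_bilinear U V).2 u).

Lemma homog_bigsum (V : superspaceType K) (I : Type) (s : seq I)
    (F : I -> V) k :
  (forall i, homog k (F i)) -> homog k (\sum_(i <- s) F i).
Proof.
move=> hF; elim/big_ind: _ => // [|x y]; first exact: homog0.
exact: homogD.
Qed.

(** The parities of the two factors add up to zero, hence coincide; a single p records both. *)
Lemma even_tensorP (U V : superspaceType K) (r : tensor U V) : homog false r ->
  exists n (a : 'I_n -> U) (b : 'I_n -> V) (p : 'I_n -> bool),
    [/\ forall i, homog (p i) (a i), forall i, homog (p i) (b i)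
      & r = \sum_i a i \ot b i].
Proof.
move=> [s [-> hs]].
have /choice [p hp] (i : 'I_(size s)) :
    exists k, homog k (tnth (in_tuple s) i).1 /\
      homog k (tnth (in_tuple s) i).2.
  have [k [l [hk hl /eqP]]] := hs _ (mem_tnth i (in_tuple s)).
  rewrite addbC => /eqP kl; exists k; split=> //.
  by case: k l kl hk hl => -[].
exists (size s), (fun i => (tnth (in_tuple s) i).1),
  (fun i => (tnth (in_tuple s) i).2), p.
split=> [i|i|]; [exact: (hp i).1|exact: (hp i).2|exact: big_tnth].
Qed.

(* [tlift] indexed by the bilinearity proof, so that it is canonically linear. *)
Definition tlin (U V W : lmodType K) (f : U -> V -> W) (fbil : bilinear_fun f) :
  tensor U V -> W := tlift f.

HB.instance Definition _ (U V W : lmodType K) (f : U -> V -> W)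
    (fbil : bilinear_fun f) :=
  GRing.isLinear.Build K (tensor U V) W *:%R (tlin fbil) (tlift_linear fbil).

Lemma tlinE (U V W : lmodType K) (f : U -> V -> W) (fbil : bilinear_fun f) u v :
  tlin fbil (u \ot v) = f u v.
Proof. exact: tliftE. Qed.

(** Going through the components of u lets a parity-dependent coefficient be part of a linear map on
    tensors. *)
Lemma scale_hpart_bilinear (U V : superspaceType K) (W : lmodType K)
    (c : bool -> K) (f : U -> V -> W) : bilinear_fun f ->
  bilinear_fun (fun u v => \sum_k c k *: f (hpart k u) v).
Proof.
move=> fbil; split=> [v a x y|u a x y] /=;
  rewrite scaler_sumr -big_split; apply: eq_bigr => k _ /=.
  by rewrite linearP (fbil.1 _ _ _ _) scalerDr !scalerA mulrC.
by rewrite (fbil.2 _ _ _ _) scalerDr !scalerA mulrC.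
Qed.

Lemma scale_hpartE (U V : superspaceType K) (W : lmodType K)
    (c : bool -> K) (f : U -> V -> W) k u v : bilinear_fun f -> homog k u ->
  \sum_l c l *: f (hpart l u) v = c k *: f u v.
Proof.
move=> fbil hu; rewrite big_bool !(hpart_id _ hu).
have f0 : f 0 v = 0.
  by have := fbil.1 v (-1) 0 0; rewrite /= scaler0 addr0 scaleN1r addNr.
by case: k {hu}; rewrite /= f0 scaler0 (addr0, add0r).
Qed.

Section SkewTensor.
Variables (L : superspaceType K) (n : nat) (a b : 'I_n -> L) (p : 'I_n -> bool).
Hypothesis ha : forall i, homog (p i) (a i).
Hypothesis hb : forall i, homog (p i) (b i).
Hypothesis r_skew : tau (\sum_i a i \ot b i) = - \sum_i a i \ot b i.

(** Apply to r_21 = -r the linear map induced by u (x) v |-> c(|u|) f v u. The weight c accommodates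
    signs that depend on p_i. *)
Lemma skew_tensor_sum (W : lmodType K) (c : bool -> K) (f : L -> L -> W) :
  bilinear_fun f ->
  \sum_i (-1) ^+ p i *: (c (p i) *: f (a i) (b i)) =
  - \sum_i c (p i) *: f (b i) (a i).
Proof.
move=> fbil; have f'bil : bilinear_fun (fun u v => f v u).
  by split=> *; [exact: fbil.2|exact: fbil.1].
have gbil := scale_hpart_bilinear c f'bil.
have /(congr1 (tlin gbil)) := r_skew.
rewrite linearN (linear_sum (@tau K L)) !(linear_sum (tlin gbil)) => e.
transitivity (\sum_i tlin gbil (tau (a i \ot b i))).
  apply: eq_bigr => i _.
  rewrite (tauE (ha i) (hb i)) andbb [RHS]linearZ_LR /= tlinE.
  by rewrite (scale_hpartE _ _ f'bil (hb i)).
rewrite e; congr (- _); apply: eq_bigr => i _.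
by rewrite /= tlinE (scale_hpartE _ _ f'bil (ha i)).
Qed.

End SkewTensor.

(** On factors of parities i, k, l the total exponent is i(k + l) + k(l + i) + l(i + k), which is
    even. *)
Lemma xi_cube (L : superspaceType K) (t : tensor L (tensor L L)) :
  xi (xi (xi t)) = t.
Proof.
pose X : {linear _ -> _} := @xi K L.
apply: (tensor_linear_ext (f := X \o (X \o X)%FUN) (g := idfun))
  => i j x t' hx _ /=.
pose f : {linear tensor L L -> _} := @tens K _ _ x.
apply: (tensor_linear_ext (f := X \o (X \o (X \o f))) (g := f))
  => k l y z hy hz /=.
rewrite (xiE hx hy hz) linearZ /= (xiE hy hz hx).
rewrite linearZ linearZ /= (xiE hz hx hy).
rewrite !scalerA -!exprD -signr_odd !oddD !oddb.
by case: i {hx} => /=; case: k {hy} => /=; case: l {hz} => /=; rewrite scale1r.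
Qed.

End Tensors.

(** * The adjoint action on the tensor square *)

HB.instance Definition _ (K : fieldType) (L : superspaceType K)
    (br : {bilinear L -> L -> L}) (alpha : {linear L -> L}) (x : L) :=
  GRing.isLinear.Build K (tensor L L) (tensor L L) *:%R (ad_ br alpha x)
    (tlift_linear (ad_fun_bilinear br alpha x)).

Section HomLieAdjoint.
Variables (K : fieldType) (L : superspaceType K).
Variables (br : {bilinear L -> L -> L}) (alpha : {linear L -> L}).
Hypothesis hL : multiplicative_hom_lie_superalgebra br alpha.

Notation "[ x , y ]" := (br x y) (at level 0).
Notation "x .: t" := (ad_ br alpha x t) (at level 40).
Notation alpha2 := (tmap alpha alpha).

Let brE i j x y (hx : homog i x) (hy : homog j y) : homog (i (+) j) [x, y] :=
  hls_br_even hL hx hy.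
Let alphaE i x (hx : homog i x) : homog i (alpha x) := hls_alpha_even hL hx.

(** Hom-Jacobi multiplied by (-1)^(|x||z|), with two brackets reversed by skew-symmetry. *)
Lemma hom_leibniz i j k x y z : homog i x -> homog j y -> homog k z ->
  [[x, y], alpha z] =
  [alpha x, [y, z]] - (-1) ^+ (i && j) *: [alpha y, [x, z]].
Proof.
move=> hx hy hz; have := hls_jacobi hL hx hy hz.
rewrite (hls_skew hL (alphaE hz) (brE hx hy)) (hls_skew hL hz hx).
rewrite linearNr linearZr_LR /=.
move=> /(congr1 (fun t => (-1) ^+ (i && k) *: t)).
rewrite !scalerDr scaler0 !scalerN !scalerA -!signr_addb.
by case: i {hx}; case: j {hy}; case: k {hz};
  rewrite /= ?expr0 ?expr1 ?scale1r ?scaleN1r ?opprK => /eqP;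
  rewrite addrAC subr_eq0 => /eqP <-; rewrite ?opprK.
Qed.

Let adDl x y t : (x + y) .: t = x .: t + y .: t.
Proof. exact: linearD (ad br alpha t) x y. Qed.

(** Multiplicativity in each factor; for alpha^(x)2 r = r it yields the co-multiplicativity of
    ad(r). *)
Lemma ad_alpha x t : alpha x .: alpha2 t = alpha2 (x .: t).
Proof.
have [x0 [x1 [h0 h1 ->]]] := homog_sum x.
rewrite linearD !adDl linearD.
suff h i y : homog i y -> alpha y .: alpha2 t = alpha2 (y .: t).
  by rewrite (h _ _ h0) (h _ _ h1).
move=> hy.
apply: (tensor_linear_ext (f := ad_ br alpha (alpha y) \o alpha2)
  (g := alpha2 \o ad_ br alpha y)) => j k u v hu hv /=.
rewrite tmapE (ad_E _ _ _ (alphaE hy) (alphaE hu)) (ad_E _ _ _ hy hu).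
by rewrite linearD linearZ /= !tmapE !(mhls_mult hL).
Qed.

(** The flip interchanges the two summands of the action. For skew r this gives tau o ad(r) = -
    ad(r). *)
Lemma tau_ad x t : tau (x .: t) = x .: tau t.
Proof.
have [x0 [x1 [h0 h1 ->]]] := homog_sum x.
rewrite !adDl linearD /=.
suff h i y : homog i y -> tau (y .: t) = y .: tau t.
  by rewrite (h _ _ h0) (h _ _ h1).
move=> hy.
apply: (tensor_linear_ext (f := @tau K L \o ad_ br alpha y)
  (g := ad_ br alpha y \o @tau K L)) => j k u v hu hv /=.
rewrite (tauE hu hv) (ad_E _ _ _ hy hu) linearD !linearZ /=.
rewrite (ad_E _ _ _ hy hv) (tauE (brE hy hu) (alphaE hv)).
rewrite (tauE (alphaE hu) (brE hy hv)) scalerDr !scalerA -!signr_addb addrC.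
by congr (_ ^+ nat_of_bool _ *: _ + _ ^+ nat_of_bool _ *: _);
  case: i {hy}; case: j {hu}; case: k {hv}.
Qed.

(** [hom_leibniz] in each factor; for alpha^(x)2 r = r this is the compatibility condition for
    ad(r). *)
Lemma ad_br i j x y t : homog i x -> homog j y ->
  [x, y] .: alpha2 t =
  alpha x .: (y .: t) - (-1) ^+ (i && j) *: (alpha y .: (x .: t)).
Proof.
move=> hx hy.
apply: (tensor_linear_ext (f := ad_ br alpha [x, y] \o alpha2)
  (g := (ad_ br alpha (alpha x) \o ad_ br alpha y) \-
        (-1) ^+ (i && j) \*: (ad_ br alpha (alpha y) \o ad_ br alpha x)))
  => k l u v hu hv /=.
rewrite tmapE (ad_E _ _ _ (brE hx hy) (alphaE hu)).
rewrite (ad_E _ _ _ hy hu) (ad_E _ _ _ hx hu) !linearD !linearZ /=.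
rewrite (ad_E _ _ _ (alphaE hx) (brE hy hu)).
rewrite (ad_E _ _ _ (alphaE hx) (alphaE hu)).
rewrite (ad_E _ _ _ (alphaE hy) (brE hx hu)).
rewrite (ad_E _ _ _ (alphaE hy) (alphaE hu)).
rewrite (hom_leibniz hx hy hu) (hom_leibniz hx hy hv) !(mhls_mult hL).
rewrite linearBl linearBr linearZl_LR linearZr_LR /=.
rewrite !(scalerDr, scalerN, scalerA) -!signr_addb.
(* E and F have x and y acting on different factors, so they are absent from the action of
   [x, y]. *)
set E := [alpha y, alpha u] \ot _; set F := [alpha x, alpha u] \ot _.
rewrite [LHS](subrDD_cross _ _ _ _ ((-1) ^+ (i && (j (+) k)) *: E)
  ((-1) ^+ (j && k) *: F)).
rewrite -opprD.
by congr (_ + _ *: _ + (_ *: _ + _ *: _) - (_ + _ *: _ + (_ *: _ + _ *: _)));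
  congr (_ ^+ nat_of_bool _);
  case: i {hx}; case: j {hy}; case: k {hu}.
Qed.

Lemma ad_even k x t : homog k x -> homog false t -> homog k (x .: t).
Proof.
move=> hx /even_tensorP[n [a [b [p [ha hb ->]]]]].
rewrite linear_sum; apply: homog_bigsum => i /=; rewrite (ad_E _ _ _ hx (ha i)).
apply: homogD; last apply: homogZ.
  by have := tensor_homog_tens (brE hx (ha i)) (alphaE (hb i));
    rewrite -addbA addbb addbF.
by have := tensor_homog_tens (alphaE (ha i)) (brE hx (hb i));
  rewrite addbCA addbb addbF.
Qed.

(** In both terms u stays in the first slot, while v is bracketed with the first or second factor of
    the other copy: the two summands of the action of v. *)
Lemma br12_23_13 (t : tensor L L) :
  br12_23 br alpha t t + br13_23 br alpha t t =
  tlift (fun u v => alpha u \ot (v .: t)) t.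
Proof.
rewrite /br12_23 /br13_23 -[X in X + _]scale1r -tlift_lin.
apply: tlift_ext => u v; rewrite scale1r -[X in X + _]scale1r -tlift_lin.
rewrite /ad_ /tlift linear_sum; apply: eq_bigr => q _ /=.
rewrite scale1r /ad_fun linearD; congr (_ + _).
rewrite /koszul linear_sum; apply: eq_bigr => i _ /=.
by rewrite linear_sum; apply: eq_bigr => j _ /=; rewrite linearZ.
Qed.

Lemma alpha_tens_ad_bilinear t :
  bilinear_fun (fun u v => alpha u \ot (v .: t)).
Proof.
split=> [v c u u'|u c v v'] /=; first by rewrite linearP linearPl.
by rewrite -[(_ + _) .: t]/(ad br alpha t (c *: v + v')) linearP linearPr.
Qed.

(** * The co-Jacobi identity for ad(r) *)

Section CoJacobi.
Variables (n : nat) (a b : 'I_n -> L) (p : 'I_n -> bool).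
Hypothesis ha : forall i, homog (p i) (a i).
Hypothesis hb : forall i, homog (p i) (b i).
Let r := \sum_i a i \ot b i.
Hypotheses (r_inv : alpha2 r = r) (r_skew : tau r = - r).
Hypothesis r_cybe : cybe br alpha r = 0.

Let r_alpha : r = \sum_i alpha (a i) \ot alpha (b i).
Proof.
by rewrite -{1}r_inv linear_sum; apply: eq_bigr => i _; rewrite /= tmapE.
Qed.

Lemma br12_13_sum : br12_13 br alpha r r = \sum_i \sum_j
  (-1) ^+ (p i && p j) *: ([a i, a j] \ot (alpha (b i) \ot alpha (b j))).
Proof.
have k u v : bilinear_fun (fun r2 s1 : L =>
    [u, s1] \ot (alpha r2 \ot alpha v)).
  by split=> [y c x x'|y c x x'] /=;
    rewrite ?linearPr ?linearPl // linearP linearPl linearPr.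
have in_bil u v : bilinear_fun (fun s1 s2 : L =>
    koszul (fun r2 s1 => [u, s1] \ot (alpha r2 \ot alpha s2)) v s1).
  split=> [t c x y|t c x y] /=.
    exact: ((koszul_bilinear (k u t)).2 v c x y).
  by apply: koszul_lin => q s; rewrite linearP !linearPr.
have out_bil : bilinear_fun (fun u v => tlift (fun s1 s2 : L =>
    koszul (fun r2 s1 => [u, s1] \ot (alpha r2 \ot alpha s2)) v s1) r).
  split=> [v c x y|u c x y] /=; rewrite -tlift_lin; apply: tlift_ext => s t.
    by apply: koszul_lin => q w; rewrite !linearPl.
  exact: ((koszul_bilinear (k u t)).1 s c x y).
rewrite /br12_13 -[LHS]/(tlin out_bil r) linear_sum.
apply: eq_bigr => i _; rewrite /= tlinE -[LHS]/(tlin (in_bil (a i) (b i)) r).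
rewrite linear_sum; apply: eq_bigr => j _; rewrite /= tlinE.
exact: (koszulE (k (a i) (b j)) (hb i) (ha j)).
Qed.

Let cyc (t : tensor L (tensor L L)) := t + xi t + xi (xi t).

Let cycD s t : cyc (s + t) = cyc s + cyc t.
Proof. by rewrite /cyc !linearD /= [s + t + _]addrACA [LHS]addrACA. Qed.

Let cyc_xi t : cyc (xi t) = cyc t.
Proof. by rewrite /cyc xi_cube addrC addrA. Qed.

Section HomogeneousElement.
Variables (e : bool) (x : L).
Hypothesis hx : homog e x.

Let A1 : tensor L (tensor L L) -> _ := tmap (br (alpha x)) alpha2.

(** In A the element [x, b_i] is bracketed with the first factor of the second copy of r, in B with
    the second factor. *)
Let A := \sum_i \sum_j (-1) ^+ (e && p i) *:
  (alpha (alpha (a i)) \ot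
    ([[x, b i], alpha (a j)] \ot alpha (alpha (b j)))).
Let B := \sum_i \sum_j (-1) ^+ (e && p i (+) (e (+) p i) && p j) *:
  (alpha (alpha (a i)) \ot
    (alpha (alpha (a j)) \ot [[x, b i], alpha (b j)])).

Lemma tmap_alpha_ad : tmap alpha (ad br alpha r) (x .: r) =
  A1 (br12_23 br alpha r r + br13_23 br alpha r r) + (A + B).
Proof.
have -> : x .: r = \sum_i x .: (a i \ot b i) by rewrite linear_sum.
have -> : br12_23 br alpha r r + br13_23 br alpha r r =
    \sum_i alpha (a i) \ot (b i .: r).
  rewrite br12_23_13 -[LHS]/(tlin (alpha_tens_ad_bilinear r) r) linear_sum.
  by apply: eq_bigr => i _ /=; rewrite tlinE.
rewrite /A1 !linear_sum /A /B -!big_split; apply: eq_bigr => i _ /=.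
rewrite (ad_E _ _ _ hx (ha i)) linearD linearZ /= !tmapE /=.
(* For the summand [x, a_i] (x) alpha b_i: as r = alpha^(x)2 r, alpha b_i acts on r as alpha^(x)2
   (b_i . r). *)
rewrite (mhls_mult hL) /ad -{1}r_inv ad_alpha; congr (_ + _).
(* This form of r puts the alpha inside the double brackets that [hom_leibniz] requires. *)
rewrite [X in _ .: X]r_alpha (linear_sum (ad_ br alpha [x, b i])).
rewrite linear_sumr scaler_sumr -big_split; apply: eq_bigr => j _ /=.
rewrite (ad_E _ _ _ (brE hx (hb i)) (alphaE (ha j))).
by rewrite linearD linearZ scalerDr scalerA -signr_addb.
Qed.

(** After the rotation only the sign (-1)^(p_i) remains, which exchanging a_i and b_i absorbs. *)
Lemma xi_A : xi A = - \sum_i \sum_j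
  [[x, a j], alpha (a i)] \ot (alpha (alpha (b i)) \ot alpha (alpha (b j))).
Proof.
rewrite /A exchange_big linear_sum -sumrN; apply: eq_bigr => j _ /=.
pose f u v :=
  [[x, v], alpha (a j)] \ot (alpha (alpha (b j)) \ot alpha (alpha u)).
have fbil : bilinear_fun f.
  by split=> [v c y z|v c y z]; rewrite /f /= ?(linearP, linearPl, linearPr).
have := skew_tensor_sum ha hb r_skew (fun=> 1) fbil.
under [in RHS]eq_bigr do rewrite scale1r.
move <-; rewrite linear_sum; apply: eq_bigr => i _ /=.
rewrite scale1r linearZ /= (xiE (alphaE (alphaE (ha i)))
  (brE (brE hx (hb i)) (alphaE (ha j))) (alphaE (alphaE (hb j)))).
rewrite scalerA -signr_addb; congr (_ ^+ nat_of_bool _ *: _).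
by case: e; case: (p i); case: (p j).
Qed.

(** Two rotations leave the sign (-1)^(p_i + p_j + p_i p_j). Exchanging a_j with b_j, then a_i with
    b_i, absorbs the first two terms, and the two minus signs cancel. *)
Lemma xi_xi_B : xi (xi B) = \sum_i \sum_j (-1) ^+ (p i && p j) *:
  ([[x, a i], alpha (a j)] \ot (alpha (alpha (b i)) \ot alpha (alpha (b j)))).
Proof.
pose f u v y z := [[x, v], alpha z] \ot (alpha (alpha u) \ot alpha (alpha y)).
have f1bil y z : bilinear_fun (fun u v => f u v y z).
  by split=> [v c w w'|v c w w']; rewrite /f /= ?(linearP, linearPl, linearPr).
have f2bil u v : bilinear_fun (f u v).
  by split=> [y c w w'|y c w w']; rewrite /f /= ?(linearP, linearPl, linearPr).
transitivity (\sum_i \sum_j (-1) ^+ p i *: ((-1) ^+ p j *: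
    ((-1) ^+ (p i && p j) *: f (a i) (b i) (a j) (b j)))).
  rewrite [xi B]linear_sum [LHS]linear_sum; apply: eq_bigr => i _ /=.
  rewrite [X in xi X]linear_sum [LHS]linear_sum; apply: eq_bigr => j _ /=.
  have hbr := brE (brE hx (hb i)) (alphaE (hb j)).
  rewrite linearZ /=.
  rewrite (xiE (alphaE (alphaE (ha i))) (alphaE (alphaE (ha j))) hbr).
  rewrite linearZ linearZ /=.
  rewrite (xiE (alphaE (alphaE (ha j))) hbr (alphaE (alphaE (ha i)))).
  rewrite !scalerA -!signr_addb; congr (_ ^+ nat_of_bool _ *: _).
  by case: e; case: (p i); case: (p j).
transitivity (\sum_i - \sum_j (-1) ^+ p i *:
    ((-1) ^+ (p i && p j) *: f (a i) (b i) (b j) (a j))).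
  apply: eq_bigr => i _; rewrite -sumrN.
  (* For fixed i the weight carries (-1)^(p_i + p_i p_j), leaving just (-1)^(p_j) for the
     exchange. *)
  have := skew_tensor_sum ha hb r_skew (fun k => (-1) ^+ (p i (+) p i && k))
    (f2bil (a i) (b i)).
  rewrite -sumrN => h.
  transitivity (\sum_j - ((-1) ^+ (p i (+) p i && p j) *:
      f (a i) (b i) (b j) (a j))).
    rewrite -h; apply: eq_bigr => j _; rewrite !scalerA -!signr_addb.
    by congr (_ ^+ nat_of_bool _ *: _); case: (p i); case: (p j).
  by apply: eq_bigr => j _; rewrite scalerA -signr_addb.
rewrite sumrN exchange_big -sumrN [RHS]exchange_big; apply: eq_bigr => j _ /=.
rewrite (skew_tensor_sum ha hb r_skew (fun k => (-1) ^+ (k && p j))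
  (f1bil (b j) (a j))).
by rewrite opprK.
Qed.

(** [hom_leibniz] splits [alpha x, [a_i, a_j]] into [[x, a_i], alpha a_j], giving xi^2 B, and a
    multiple of [alpha a_i, [x, a_j]], which skew-symmetry turns into xi A. *)
Lemma A1_br12_13 : A1 (br12_13 br alpha r r) = xi A + xi (xi B).
Proof.
rewrite /A1 xi_A xi_xi_B br12_13_sum -sumrN -big_split [LHS]linear_sum.
apply: eq_bigr => i _ /=; rewrite -sumrN -big_split [LHS]linear_sum.
apply: eq_bigr => j _ /=; rewrite linearZ /= !tmapE /=.
rewrite (hom_leibniz hx (ha i) (ha j)) linearBl linearZl_LR /=.
rewrite (hls_skew hL (brE hx (ha j)) (alphaE (ha i))) linearNl linearZl_LR /=.
rewrite scalerBr opprK !scalerA -!signr_addb addrC -addrA.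
rewrite tmapE (_ : (e (+) p j) && p i = (p i && p j) (+) (e && p i)).
  by rewrite addNr addr0.
by case: (e); case: (p i); case: (p j).
Qed.

Lemma cojacobi_homog : cyc (tmap alpha (ad br alpha r) (x .: r)) = 0.
Proof.
(* Cyclic sums are invariant under xi, so A + B may be replaced by xi A + xi^2 B. *)
rewrite tmap_alpha_ad !cycD -(cyc_xi A) -(cyc_xi B) -(cyc_xi (xi B)) -!cycD.
rewrite -A1_br12_13 -linearD /= [_ + br12_13 _ _ _ _]addrC addrA.
by rewrite -/(cybe br alpha r) r_cybe linear0 /cyc !linear0 !addr0.
Qed.

End HomogeneousElement.

Lemma ad_cojacobi x : cyc (tmap alpha (ad br alpha r) (x .: r)) = 0.
Proof.
have [x0 [x1 [h0 h1 ->]]] := homog_sum x.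
by rewrite adDl linearD cycD (cojacobi_homog h0) (cojacobi_homog h1) addr0.
Qed.

End CoJacobi.

End HomLieAdjoint.

(** * Assembly of the superbialgebra *)

Theorem corollary3p14 (K : fieldType) (charK0 : [pchar K] =i pred0)
    (L : superspaceType K) (br : {bilinear L -> L -> L})
    (alpha : {linear L -> L}) (r : tensor L L)
    (hL : multiplicative_hom_lie_superalgebra br alpha)
    (r_even : homog false r)
    (r_inv : tmap alpha alpha r = r)
    (r_skew : tau r = - r)
    (r_cybe : cybe br alpha r = 0) :
  multiplicative_quasitriangular br (ad br alpha r) alpha r.
Proof.
have half_half : 2%:R^-1 + 2%:R^-1 = 1 :> K.
  by rewrite -[LHS]mulr2n -[LHS]mulr_natr mulVf //; move/pcharf0P: charK0 => ->.
split=> //; split=> //; split=> //; last first.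
  by move=> i j x y hx hy; rewrite -(ad_br hL _ hx hy) r_inv.
split; last by move=> x; rewrite -(ad_alpha hL) r_inv.
split.
- exact: hls_alpha_even hL.
- by move=> i x hx; exact: ad_even.
(* Since tau negates ad(r)(x), half of it is a preimage under 1 - tau. *)
- move=> x; exists (2%:R^-1 *: ad br alpha r x).
  rewrite [X in _ - X]linearZ_LR /= (tau_ad hL) r_skew linearN scalerN opprK.
  by rewrite -scalerDl half_half scale1r.
- have [n [a [b [p [ha hb rE]]]]] := even_tensorP r_even.
  move=> x /=; move: r_inv r_skew r_cybe; rewrite rE.
  by move=> *; apply: (ad_cojacobi hL ha hb).
Qed.
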